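(* Let $P=\{P_n(x)\}_{n=0}^\infty$ be a classical orthogonal polynomial sequence on an interval $(l,r)\subseteq\mathbb{R}$ with weight function $w$, satisfying $f P_n''+gP_n'+h_nP_n=0$ and $$\frac{w'(x)}{w(x)}=\frac{g(x)-f'(x)}{f(x)}$$ on $(l,r)$. Let $M(x)=\frac{ax+b}{cx+d}$ with $a,b,c,d\in\mathbb{C}$ and $\Delta=ad-bc\ne0$, and let $$\omega(x)=w(M(x))M'(x)=\Delta\frac{w(M(x))}{(cx+d)^2},\qquad \omega_{m,n}(x)=\frac{\omega(x)}{(cx+d)^{m+n}}$$ be the weight functions of the Möbius-transformed rational functions $R_n(x)=P_n(M(x))$ and polynomials $Q_n(x)=(cx+d)^nP_n(M(x))$. Then $$\frac{\omega'(x)}{\omega(x)}=\frac{G(x)-F'(x)}{F(x)},$$ and, for all $m,n\ge0$, $$\frac{\omega_{m,n}'(x)}{\omega_{m,n}(x)}=\frac{1}{\mathcal{F}(x)}\left[\frac{\mathcal{G}_m(x)+\mathcal{G}_n(x)}{2}-\mathcal{F}'(x)\right],$$ where $$F(x)=\mathcal{F}(x)=\frac{(cx+d)^4}{\Delta^2}f(M(x)),\qquad G(x)=\frac{2c(cx+d)^3}{\Delta^2}f(M(x))+\frac{(cx+d)^2}{\Delta}g(M(x)),$$ $$\mathcal{G}_n(x)=G(x)-\frac{2cn}{cx+d}F(x)=-\frac{2c(n-1)(cx+d)^3}{\Delta^2}f(M(x))+\frac{(cx+d)^2}{\Delta}g(M(x)).$$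
   Context: A classical orthogonal polynomial sequence is a sequence of real polynomials $P_n$, $\deg P_n=n$, orthogonal on $(l,r)$ with respect to a weight $w$ (here differentiable and nonvanishing on $(l,r)$), such that $f(x)P_n''(x)+g(x)P_n'(x)+h_nP_n(x)=0$ for all $n\ge0$, where $f$ and $g$ are polynomials of degrees at most $2$ and $1$ independent of $n$, $f$ does not vanish on $(l,r)$, and $h_n$ are constants. The functions $\omega$ and $\omega_{m,n}$ are considered at the finite points of the curve $\Gamma=\{W(t):l<t<r\}\subset\mathbb{C}_\infty$, where $W(x)=-\frac{dx-b}{cx-a}$ is the inverse of $M$ (so $M(x)\in(l,r)$ for $x\in\Gamma$), and the derivatives $\omega',\omega_{m,n}'$ are taken along $\Gamma$, i.e. $\omega'(W(t))=\frac{d}{dt}[\omega(W(t))]/W'(t)$. *)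

(* Defs.v *)
From mathcomp Require Import all_boot all_order all_algebra.
From mathcomp Require Import complex.
From mathcomp Require Import all_classical all_reals all_analysis.
Set Implicit Arguments.
Unset Strict Implicit.
Unset Printing Implicit Defensive.
Import Order.TTheory GRing.Theory Num.Theory numFieldNormedType.Exports.
Local Open Scope classical_set_scope.
Local Open Scope complex_scope.
Local Open Scope ring_scope.

Definition open_itv (R : realType) (l r : \bar R) : set R :=
  [set t | (l < t%:E < r)%E].

(* Only the values of w on (l, r) matter. *)
Record classical_ops (R : realType) (l r : \bar R) (w : R -> R)
    (P : nat -> {poly R}) (f g : {poly R}) (h : nat -> R) : Prop := {
  ops_itv : (l < r)%E;
  ops_weight_derivable : forall t, open_itv l r t -> derivable w t 1;
  ops_weight_neq0 : forall t, open_itv l r t -> w t != 0;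
  ops_size : forall n, size (P n) = n.+1;
  ops_integrable : forall m n,
    lebesgue_measure.-integrable (open_itv l r)
      (fun t : R => ((P m).[t] * (P n).[t] * w t)%:E);
  ops_orthogonal : forall m n, m != n ->
    \int[lebesgue_measure]_(t in open_itv l r)
      ((P m).[t] * (P n).[t] * w t) = 0;
  ops_norm_neq0 : forall n,
    \int[lebesgue_measure]_(t in open_itv l r)
      ((P n).[t] * (P n).[t] * w t) != 0;
  ops_size_f : (size f <= 3)%N;
  ops_size_g : (size g <= 2)%N;
  ops_f_neq0 : forall t, open_itv l r t -> f.[t] != 0;
  ops_ode : forall n,
    f * deriv (deriv (P n)) + g * deriv (P n) + h n *: P n = 0
}.

(* Complex derivative of a function of a complex variable; R[i]^o is R[i]
   carrying its normed-space structure over itself. *)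
Definition cderive (R : realType) (F : R[i] -> R[i]) (x : R[i]) : R[i] :=
  @derive1 R[i] R[i]^o F x.

Definition cderivable (R : realType) (F : R[i] -> R[i]) (x : R[i]) : Prop :=
  @derivable R[i] R[i]^o R[i]^o F x 1.

(* Derivative of a complex-valued function of a real variable. *)
Definition curve_quotient (R : realType) (u : R -> R[i]) (t h : R) : R[i]^o :=
  (u (h + t) - u t) / h%:C.

Definition curve_derive (R : realType) (u : R -> R[i]) (t : R) : R[i] :=
  lim (curve_quotient u t h @[h --> 0^']).

Definition curve_derivable (R : realType) (u : R -> R[i]) (t : R) : Prop :=
  cvg (curve_quotient u t h @[h --> 0^']).

Section Mobius.
Variables (R : realType) (a b c d : R[i]).

Definition mobius_det : R[i] := a * d - b * c.

Definition mobius (x : R[i]) : R[i] := (a * x + b) / (c * x + d).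

Definition mobius_inv (x : R[i]) : R[i] := - ((d * x - b) / (c * x - a)).

(* The finite points of the curve: the parameter t = a / c, sent to the point
   at infinity, is excluded. *)
Definition Gamma (l r : \bar R) : set R[i] :=
  [set x | exists t : R,
     [/\ open_itv l r t, c * t%:C - a != 0 & x = mobius_inv t%:C]].

(* For x on the curve, mobius x is real and is the parameter t of x. *)
Definition param (x : R[i]) : R := complex.Re (mobius x).

Definition derivable_along (u : R[i] -> R[i]) (x : R[i]) : Prop :=
  curve_derivable (fun t : R => u (mobius_inv t%:C)) (param x).

Definition derive_along (u : R[i] -> R[i]) (x : R[i]) : R[i] :=
  curve_derive (fun t : R => u (mobius_inv t%:C)) (param x) /
  curve_derive (fun t : R => mobius_inv t%:C) (param x).

(* w is defined on reals, hence is read at the real number mobius x. *)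
Definition omega (w : R -> R) (x : R[i]) : R[i] :=
  (w (param x))%:C * cderive mobius x.

Definition omega_mn (w : R -> R) (m n : nat) (x : R[i]) : R[i] :=
  omega w x / (c * x + d) ^+ (m + n).

Definition poly_mobius (p : {poly R}) (x : R[i]) : R[i] :=
  (map_poly (real_complex R) p).[mobius x].

Definition mobF (f : {poly R}) (x : R[i]) : R[i] :=
  (c * x + d) ^+ 4 / mobius_det ^+ 2 * poly_mobius f x.

Definition mobG (f g : {poly R}) (x : R[i]) : R[i] :=
  2 * c * (c * x + d) ^+ 3 / mobius_det ^+ 2 * poly_mobius f x
  + (c * x + d) ^+ 2 / mobius_det * poly_mobius g x.

Definition mobG_n (f g : {poly R}) (n : nat) (x : R[i]) : R[i] :=
  mobG f g x - 2 * c * n%:R / (c * x + d) * mobF f x.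

End Mobius.

(* Main.v *)
(* On the curve x = W(t) one has M(x) = t and c x + d = - Delta / (c t - a), so
   omega_mn (W t) is the real weight w(t) times the polynomial in t
   (Delta (- Delta)^(m+n))^-1 (c t - a)^(m+n+2).  Its logarithmic derivative in t
   is w'/w + (m+n+2) c / (c t - a); dividing by W'(t) = Delta / (c t - a)^2 and
   using the Pearson equation for w'/w leaves an identity of rational functions.
   The statement on omega is the case m = n = 0. *)
Require Import Defs.
From mathcomp Require Import all_boot all_order all_algebra.
From mathcomp Require Import complex.
From mathcomp Require Import all_classical all_reals all_analysis.
From mathcomp Require Import ring.
Import Order.TTheory GRing.Theory Num.Theory numFieldNormedType.Exports.
Local Open Scope classical_set_scope.
Local Open Scope complex_scope.
Local Open Scope ring_scope.

(** * Derivative rules over a numeric field *)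

Lemma is_derive_div (K : numFieldType) (u v : K -> K) (x du dv : K) :
  v x != 0 -> is_derive x 1 u du -> is_derive x 1 v dv ->
  is_derive x 1 (fun y => u y / v y : K) ((du * v x - u x * dv) / v x ^+ 2).
Proof.
move=> vx0 Du Dv.
have Dvi : is_derive x 1 (fun y => (v y)^-1 : K) (- (v x) ^- 2 *: dv).
  apply: DeriveDef; first exact: derivableV.
  by rewrite deriveV // derive_val.
apply: is_derive_eq (@is_deriveM _ _ _ _ _ _ _ _ Du Dvi) _.
by rewrite /GRing.scale /=; field.
Qed.

(** Induction on the Horner form p * X + k with the product rule. This one rule serves both for
    powers of affine functions and for f(M(x)). *)
Lemma is_derive_horner_comp (K : numFieldType) (p : {poly K}) (u : K -> K)
    (x du : K) :
  is_derive x 1 u du ->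
  is_derive x 1 (fun y => p.[u y] : K) (p^`().[u x] * du).
Proof.
move=> Du; elim/poly_ind: p => [|p k IH].
  rewrite deriv0 horner0 mul0r.
  rewrite (_ : (fun _ => _) = cst 0); first exact: is_derive_cst.
  by apply/funext => y; rewrite horner0.
rewrite (_ : (fun _ => _) = (fun y => p.[u y] : K) * u + cst k); last first.
  by apply/funext => y; rewrite !hornerE.
have Dpu := @is_deriveM _ _ _ _ _ _ _ _ IH Du.
apply: is_derive_eq (@is_deriveD _ _ _ _ _ _ _ _ _ Dpu (is_derive_cst k x 1)) _.
by rewrite /GRing.scale /= derivD derivM derivX derivC !hornerE /=; ring.
Qed.

Lemma is_derive_affine (K : numFieldType) (c d x : K) :
  is_derive x 1 (fun y => c * y + d : K) c.
Proof.
rewrite (_ : (fun _ => _) = (fun y : K => (c *: 'X + d%:P : {poly K}).[y] : K)).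
  apply: is_derive_eq.
    exact: (is_derive_horner_comp _ (c *: 'X + d%:P) id x 1 (is_derive_id x 1)).
  by rewrite derivD derivZ derivX derivC !hornerE.
by apply/funext => y; rewrite !hornerE.
Qed.

Lemma is_derive1E (K : numFieldType) (u : K -> K) (x du : K) :
  is_derive x 1 u du -> derive1 u x = du.
Proof. by move=> Du; rewrite derive1E derive_val. Qed.

(** Removes the direction 1 and the scaling from the quotient behind [derivable], leaving the shape
    that [curve_quotient] has. *)
Lemma is_derive_cvg (K : numFieldType) (u : K -> K) (x du : K) :
  is_derive x 1 u du -> (u (h + x) - u x) / h @[h --> (0 : K)^'] --> du.
Proof.
move=> Du; have /cvg_ex[l Hl] := @ex_derive _ _ _ _ _ _ _ Du.
have <- : l = du by rewrite -(@derive_val _ _ _ _ _ _ _ Du); apply/esym/cvg_lim.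
apply: cvg_trans Hl; apply: near_eq_cvg; apply: nearW => h.
by rewrite /GRing.scale /= mulr1 mulrC.
Qed.

(** * Difference quotients in a real variable with complex values *)

Section Curve.
Context {R : realType}.
Local Notation C := (R[i]^o).

Lemma normCR (x : R) : `|x%:C| = `|x|%:C :> R[i].
Proof. by rewrite normc_def /= expr0n /= addr0 sqrtr_sqr. Qed.

Lemma real_complex_continuous : continuous (fun t : R => t%:C : C).
Proof.
move=> t; apply/cvgrPdist_lt => e e0.
(* In the order on [R[i]], 0 < e forces the imaginary part of e to vanish, so the radius can be
   treated as a real number. *)
have e_re : e = (complex.Re e)%:C.
  by move: e0; case: e => er ei; rewrite ltcE /= => /andP[/eqP -> _].
have re0 : 0 < complex.Re e by move: e0; rewrite {1}e_re ltcR.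
near=> s.
rewrite -rmorphB [X in X < _](_ : _ = `|t - s|%:C); last exact: normCR.
rewrite e_re ltcR; near: s.
by have /cvgrPdist_lt/(_ _ re0) : id @ nbhs t --> t by exact: cvg_id.
Unshelve. all: by end_near. Qed.

(** Nonzero real increments stay nonzero in the complex plane, so a complex difference quotient may
    be restricted to them. *)
Lemma real_complex_dnbhs0 : (h%:C : C) @[h --> (0 : R)^'] --> (0 : C)^'.
Proof.
move=> A HA; have := real_complex_continuous 0 _ HA.
apply: (@filterS _ (nbhs (0 : R))) => h + h0; apply.
by move: h0; rewrite eq_complex /= eqxx andbT.
Qed.

Lemma cvg_curve_quotient_complex (u : C -> C) (t : R) (du : C) :
  is_derive (t%:C : C) 1 u du ->
  curve_quotient (fun s => u s%:C) t h @[h --> 0^'] --> (du : C).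
Proof.
move=> /is_derive_cvg Du.
apply: cvg_trans (cvg_comp _ _ real_complex_dnbhs0 Du).
apply: near_eq_cvg; apply: nearW => h.
by rewrite /curve_quotient /= rmorphD.
Qed.

Lemma cvg_curve_quotient_real (w : R -> R) (t : R) : derivable w t 1 ->
  curve_quotient (fun s => (w s)%:C) t h @[h --> 0^'] --> ((derive1 w t)%:C : C).
Proof.
move=> /derivableP Dw.
have := @is_derive_cvg R w t _ Dw; rewrite -derive1E => Dw'.
apply: cvg_trans (cvg_comp _ _ Dw' (real_complex_continuous _)).
apply: near_eq_cvg; apply: nearW => h.
by rewrite /curve_quotient /= rmorphM rmorphB fmorphV.
Qed.

(** Meant for a factor w with only a real derivative times a complex function restricted to the
    reals. The increment of u v is split as (u(t+h) - u(t)) v(t+h) + u(t) (v(t+h) - v(t)). *)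
Lemma cvg_curve_quotientM (u v : R -> C) (t : R) (du dv : C) :
  curve_quotient u t h @[h --> 0^'] --> du ->
  curve_quotient v t h @[h --> 0^'] --> dv ->
  curve_quotient (fun s => u s * v s) t h @[h --> 0^'] --> (du * v t + u t * dv : C).
Proof.
move=> Du Dv.
have h0 : (h%:C : C) @[h --> (0 : R)^'] --> (0 : C).
  exact: cvg_trans real_complex_dnbhs0 (@cvg_within _ (nbhs (0 : C)) _ _).
(* Continuity of v at t: v(h + t) is the quotient times h plus v(t), and the first term tends to dv
   * 0. *)
have vt : v (h + t) @[h --> (0 : R)^'] --> (v t : C).
  have Dvh : curve_quotient v t h * h%:C @[h --> (0 : R)^'] --> (dv * 0 : C).
    exact: (@cvgM R[i] _ _ _ _ _ _ _ Dv h0).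
  have L : curve_quotient v t h * h%:C + v t @[h --> (0 : R)^'] --> (v t : C).
    rewrite -[X in _ --> X]add0r -[X in _ --> X + _](mulr0 dv).
    exact: (cvgD Dvh (cvg_cst (v t : C))).
  apply: cvg_trans L; apply: near_eq_cvg; near=> h.
  have hn0 : h%:C != 0 :> R[i].
    rewrite eq_complex /= eqxx andbT.
    by near: h; exact: nbhs_dnbhs_neq.
  by rewrite /curve_quotient /= divfK // subrK.
have L1 : curve_quotient u t h * v (h + t) @[h --> (0 : R)^'] --> (du * v t : C).
  exact: (@cvgM R[i] _ _ _ _ _ _ _ Du vt).
have L2 : u t * curve_quotient v t h @[h --> (0 : R)^'] --> (u t * dv : C).
  exact: (@cvgM R[i] _ _ _ _ _ _ _ (@cvg_cst C (u t) _ _ _) Dv).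
have L3 : curve_quotient u t h * v (h + t) + u t * curve_quotient v t h
    @[h --> (0 : R)^'] --> (du * v t + u t * dv : C).
  exact: (cvgD L1 L2).
apply: cvg_trans L3; apply: near_eq_cvg; near=> h.
by rewrite /curve_quotient /=; ring.
Unshelve. all: by end_near. Qed.

(** Needed because the closed form of the weight along the curve is available only where c s - a is
    nonzero. *)
Lemma near_eq_cvg_curve_quotient (u v : R -> C) (t : R) (du : C) :
  (\forall s \near t, u s = v s) ->
  curve_quotient u t h @[h --> 0^'] --> du ->
  curve_quotient v t h @[h --> 0^'] --> du.
Proof.
move=> uv; apply: cvg_trans; apply: near_eq_cvg.
have uvt := nbhs_singleton uv.
have ht : (h + t) @[h --> (0 : R)^'] --> t.
  rewrite -[X in _ --> X]add0r; apply: cvgD; last exact: cvg_cst.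
  exact: cvg_within.
near=> h; rewrite /curve_quotient uvt; congr ((_ - _) / _).
by near: h; exact: (ht _ uv).
Unshelve. all: by end_near. Qed.

Lemma curve_deriveE (u : R -> C) (t : R) (du : C) :
  curve_quotient u t h @[h --> 0^'] --> du -> curve_derive u t = du.
Proof. by move=> Du; apply: cvg_lim Du; exact: norm_hausdorff. Qed.

End Curve.

(** * The Möbius map, its inverse, and the weights along the curve *)

Section MobiusDerive.
Context {R : realType}.
Local Notation C := (R[i]^o).
Implicit Types (a b c d x : C) (t : R).

Lemma is_derive_mobius a b c d x : c * x + d != 0 ->
  is_derive x 1 (mobius a b c d : C -> C)
    (mobius_det a b c d / (c * x + d) ^+ 2 : C).
Proof.
move=> x0.
have M := @is_derive_div R[i] _ _ x a c x0 (is_derive_affine R[i] a b x)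
  (is_derive_affine R[i] c d x).
by apply: is_derive_eq M _; rewrite /mobius_det; congr (_ / _); ring.
Qed.

(** The matrix (-d, b; c, -a) again has determinant Delta, so W' follows from the formula for M'. *)
Lemma mobius_invE a b c d : mobius_inv a b c d = mobius (- d) b c (- a).
Proof.
by apply/funext => x; rewrite /mobius_inv /mobius -mulNr opprB mulNr addrC.
Qed.

Lemma is_derive_mobius_inv a b c d x : c * x - a != 0 ->
  is_derive x 1 (mobius_inv a b c d : C -> C)
    (mobius_det a b c d / (c * x - a) ^+ 2 : C).
Proof.
rewrite mobius_invE => x0; apply: is_derive_eq (is_derive_mobius _ _ _ _ _ x0) _.
by congr (_ / _); rewrite /mobius_det; ring.
Qed.

Lemma is_derive_mobF a b c d (f : {poly R}) x :
  c * x + d != 0 -> mobius_det a b c d != 0 ->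
  is_derive x 1 (mobF a b c d f : C -> C)
    (4 * c * (c * x + d) ^+ 3 / mobius_det a b c d ^+ 2 * poly_mobius a b c d f x
     + (c * x + d) ^+ 2 / mobius_det a b c d * poly_mobius a b c d (deriv f) x : C).
Proof.
move=> x0 D0; set D := mobius_det a b c d in D0 *.
(* F is the value of Delta^-2 X^4 at c x + d times the value of f at M(x). In the second term of the
   product rule, M' = Delta / (c x + d)^2 lowers the power 4 to 2 and cancels one Delta. *)
have D4 := is_derive_horner_comp R[i] ((D ^- 2) *: 'X^4) _ x _
  (is_derive_affine R[i] c d x).
have Df := is_derive_horner_comp R[i] (map_poly (real_complex R) f) _ x _
  (is_derive_mobius a b c d x x0).
have := @is_deriveM R[i] _ _ _ _ _ _ _ D4 Df.
rewrite [X in is_derive _ _ X](_ : _ = (mobF a b c d f : C -> C)); last first.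
  apply/funext => y; rewrite /mobF -/D.
  rewrite -[LHS]/((D ^- 2 *: 'X^4).[c * y + d] * poly_mobius a b c d f y).
  by rewrite hornerZ hornerXn [X in X * _]mulrC.
move=> DF; apply: is_derive_eq DF _; rewrite /poly_mobius -deriv_map /GRing.scale /=.
rewrite derivZ derivXn !hornerE /= -/D.
by field; rewrite D0.
Qed.

Lemma mobius_inv_denom a b c d x : c * x - a != 0 ->
  c * mobius_inv a b c d x + d = - mobius_det a b c d / (c * x - a).
Proof. by move=> x0; rewrite /mobius_inv /mobius_det; field. Qed.

Lemma mobius_invK a b c d x : c * x - a != 0 -> mobius_det a b c d != 0 ->
  mobius a b c d (mobius_inv a b c d x) = x.
Proof.
move=> x0 D0; rewrite /mobius mobius_inv_denom //.
have -> : a * mobius_inv a b c d x + b = - mobius_det a b c d * x / (c * x - a).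
  by rewrite /mobius_inv /mobius_det; field.
by field; rewrite x0.
Qed.

Lemma param_mobius_inv a b c d t : c * t%:C - a != 0 ->
  mobius_det a b c d != 0 -> param a b c d (mobius_inv a b c d t%:C) = t.
Proof. by move=> t0 D0; rewrite /param mobius_invK. Qed.

(** M'(x) contributes (c t - a)^2 / Delta, and each of the m + n divisions by c x + d contributes (c
    t - a) / (- Delta). The polynomial form lets the Horner rule differentiate the result. *)
Lemma omega_mn_mobius_inv a b c d w m n t : c * t%:C - a != 0 ->
  mobius_det a b c d != 0 ->
  omega_mn a b c d w m n (mobius_inv a b c d t%:C) =
    (w t)%:C * (((mobius_det a b c d * (- mobius_det a b c d) ^+ (m + n))^-1
      *: 'X^((m + n).+2)).[c * t%:C - a]).
Proof.
move=> t0 D0; have dE := mobius_inv_denom _ b _ d _ t0.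
rewrite /omega_mn /omega param_mobius_inv // /cderive.
rewrite (is_derive1E R[i] _ _ _ (is_derive_mobius _ _ _ _ _ _)) dE; last first.
  by rewrite mulf_neq0 ?invr_eq0 ?oppr_eq0.
rewrite hornerZ hornerXn !expr_div_n [_ ^+ (m + n).+2]exprS [_ ^+ (m + n).+1]exprS.
have uk0 : (c * t%:C - a) ^+ (m + n) != 0 by rewrite expf_neq0.
have Dk0 : (- mobius_det a b c d) ^+ (m + n) != 0 by rewrite expf_neq0 // oppr_eq0.
(* The exponent m + n is symbolic, so both powers become atoms for [field]. *)
move: uk0 Dk0; set A := (_ - a) ^+ _; set B := (- _) ^+ _ => uk0 Dk0.
by field; rewrite t0 D0 uk0 Dk0.
Qed.

Lemma near_denom_neq0 a c t : c * t%:C - a != 0 ->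
  \forall s \near t, c * s%:C - a != 0.
Proof.
move=> t0.
have L1 : c * s%:C @[s --> t] --> (c * t%:C : C).
  exact: (@cvgM R[i] _ _ _ _ _ _ _ (@cvg_cst C c _ _ _) (real_complex_continuous t)).
have L : c * s%:C - a @[s --> t] --> (c * t%:C - a : C).
  exact: (cvgB L1 (cvg_cst (a : C))).
exact: (cvgr_neq0 _ L t0).
Qed.

Lemma cvg_curve_quotient_omega_mn a b c d w m n t : derivable w t 1 ->
  c * t%:C - a != 0 -> mobius_det a b c d != 0 ->
  let q : {poly R[i]} :=
    (mobius_det a b c d * (- mobius_det a b c d) ^+ (m + n))^-1 *: 'X^((m + n).+2) in
  curve_quotient (fun s => omega_mn a b c d w m n (mobius_inv a b c d s%:C)) t h
    @[h --> 0^'] --> ((derive1 w t)%:C * q.[c * t%:C - a]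
                       + (w t)%:C * (q^`().[c * t%:C - a] * c) : C).
Proof.
move=> Dw t0 D0 q.
have Dq := cvg_curve_quotient_complex _ _ _ (is_derive_horner_comp R[i] q _ t%:C _
  (is_derive_affine R[i] c (- a) t%:C)).
have := cvg_curve_quotientM _ _ _ _ _ (cvg_curve_quotient_real _ _ Dw) Dq.
apply: near_eq_cvg_curve_quotient; apply: filterS (near_denom_neq0 _ _ _ t0) => s s0.
by rewrite omega_mn_mobius_inv.
Qed.

Lemma derive_along_curve a b c d (u : C -> C) t (du : C) :
  c * t%:C - a != 0 -> mobius_det a b c d != 0 ->
  curve_quotient (fun s => u (mobius_inv a b c d s%:C)) t h @[h --> 0^'] --> du ->
  derivable_along a b c d u (mobius_inv a b c d t%:C) /\
  derive_along a b c d u (mobius_inv a b c d t%:C) =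
    du / (mobius_det a b c d / (c * t%:C - a) ^+ 2).
Proof.
move=> t0 D0 Du.
have DW := cvg_curve_quotient_complex _ _ _ (is_derive_mobius_inv a b c d _ t0).
rewrite /derivable_along /derive_along (param_mobius_inv _ _ _ _ _ t0 D0); split.
  exact: (@cvgP R[i]^o _ du Du).
by rewrite (curve_deriveE _ _ _ Du) (curve_deriveE _ _ _ DW).
Qed.

End MobiusDerive.

(** * The transformed Pearson equations *)

Lemma mobG_nE (R : realType) (a b c d : R[i]) (f g : {poly R}) (n : nat) (x : R[i]) :
  c * x + d != 0 -> mobius_det a b c d != 0 ->
  mobG_n a b c d f g n x =
    - (2 * c * (n%:R - 1) * (c * x + d) ^+ 3 / mobius_det a b c d ^+ 2)
        * poly_mobius a b c d f x
    + (c * x + d) ^+ 2 / mobius_det a b c d * poly_mobius a b c d g x.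
Proof.
by move=> x0 D0; rewrite /mobG_n /mobG /mobF; field; rewrite x0 D0.
Qed.

Theorem theorem9 (R : realType) (l r : \bar R) (w : R -> R)
    (P : nat -> {poly R}) (f g : {poly R}) (h : nat -> R)
    (hP : classical_ops l r w P f g h)
    (hw : forall t : R, open_itv l r t ->
      derive1 w t / w t = (g.[t] - (deriv f).[t]) / f.[t])
    (a b c d : R[i]) (hD : mobius_det a b c d != 0) :
  let Delta := mobius_det a b c d in
  let om := omega a b c d w in
  let om_mn := omega_mn a b c d w in
  let F := mobF a b c d f in
  let G := mobG a b c d f g in
  let G_n := mobG_n a b c d f g in
  (forall x : R[i], Gamma a b c d l r x ->
    [/\ om x = Delta * ((w (param a b c d x))%:C / (c * x + d) ^+ 2),
        derivable_along a b c d om x,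
        cderivable F x
      & derive_along a b c d om x / om x = (G x - cderive F x) / F x]) /\
  (forall (m n : nat) (x : R[i]), Gamma a b c d l r x ->
    [/\ G_n n x =
          - (2 * c * (n%:R - 1) * (c * x + d) ^+ 3 / Delta ^+ 2)
              * poly_mobius a b c d f x
          + (c * x + d) ^+ 2 / Delta * poly_mobius a b c d g x,
        derivable_along a b c d (om_mn m n) x
      & derive_along a b c d (om_mn m n) x / om_mn m n x =
          1 / F x * ((G_n m x + G_n n x) / 2 - cderive F x)]).
Proof.
move=> Delta om om_mn F G G_n.
have D0 : Delta != 0 by [].
have main m n x : Gamma a b c d l r x ->
    [/\ G_n n x =
          - (2 * c * (n%:R - 1) * (c * x + d) ^+ 3 / Delta ^+ 2)
              * poly_mobius a b c d f x
          + (c * x + d) ^+ 2 / Delta * poly_mobius a b c d g x,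
        derivable_along a b c d (om_mn m n) x
      & derive_along a b c d (om_mn m n) x / om_mn m n x =
          1 / F x * ((G_n m x + G_n n x) / 2 - cderive F x)].
  move=> [t [tlr t0 ->]].
  have z0 : c * mobius_inv a b c d t%:C + d != 0.
    by rewrite mobius_inv_denom // mulf_neq0 ?invr_eq0 ?oppr_eq0.
  have Dom := cvg_curve_quotient_omega_mn a b _ d _ m n _
    (ops_weight_derivable hP tlr) t0 hD.
  have [dom dE] := derive_along_curve _ _ _ _ _ _ _ t0 hD Dom.
  split; [exact: mobG_nE|exact: dom|].
  rewrite dE /om_mn omega_mn_mobius_inv //.
  rewrite /F /cderive (is_derive1E _ _ _ _ (is_derive_mobF _ _ _ _ f _ z0 hD)).
  (* With M(x) = t and c x + d = - Delta / (c t - a), both sides become expressions in t; f, f' and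
     g are then evaluated at a real point, so their values are embedded reals. *)
  rewrite /G_n !mobG_nE // /mobF mobius_inv_denom // /poly_mobius mobius_invK //.
  rewrite !horner_map /=.
  have w0 := ops_weight_neq0 hP tlr; have f0 := ops_f_neq0 hP tlr.
  (* Since w(t) is nonzero, the Pearson equation can be solved for w'(t). *)
  have -> : derive1 w t = w t * (g.[t] - (deriv f).[t]) / f.[t].
    by rewrite -mulrA -hw //; field.
  rewrite !rmorphM rmorphB fmorphV /=.
  have wC0 : (w t)%:C != 0 by rewrite fmorph_eq0.
  have fC0 : f.[t]%:C != 0 by rewrite fmorph_eq0.
  rewrite derivZ derivXn !hornerZ hornerMn !hornerXn /=.
  (* The exponent brought down by differentiation must appear as m + n + 2 in the field, to match
     the separate m and n in the average of G_m and G_n. *)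
  rewrite -mulr_natr [_ ^+ (m + n).+2]exprS [_ ^+ (m + n).+1]exprS.
  rewrite -addn2 !natrD.
  have uk0 : (c * t%:C - a) ^+ (m + n) != 0 by rewrite expf_neq0.
  have Dk0 : (- Delta) ^+ (m + n) != 0 by rewrite expf_neq0 // oppr_eq0.
  move: uk0 Dk0; rewrite -/Delta.
  set A := (_ - a) ^+ _; set B := (- _) ^+ _ => uk0 Dk0.
  by field; rewrite t0 D0 uk0 Dk0 wC0 fC0.
split=> [x xG|m n x]; last exact: main.
(* At m = n = 0 the extra power of c x + d is 1 and the correction 2 c n F / (c x + d) vanishes, so
   the average of G_0 with itself is G. *)
have om0 : om_mn 0 0 = om.
  by apply/funext => y; rewrite /om_mn /omega_mn expr0 divr1.
have G0 : G_n 0 x = G x by rewrite /G_n /mobG_n mulr0 !mul0r subr0.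
have [_] := main 0 0 x xG; rewrite om0 G0 => Dom ->.
have z0 : c * x + d != 0.
  case: xG => t [_ t0 ->].
  by rewrite mobius_inv_denom // mulf_neq0 ?invr_eq0 ?oppr_eq0.
have DF := @ex_derive _ _ _ _ _ _ _ (is_derive_mobF _ _ _ _ f _ z0 hD).
split; [|exact: Dom|exact: DF|].
  rewrite /om /omega /cderive (is_derive1E _ _ _ _ (is_derive_mobius _ _ _ _ _ z0)).
  exact: mulrCA.
have -> : (G x + G x) / 2 = G x by field.
by rewrite mul1r mulrC.
Qed.
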